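(* Let $\alpha,\beta>0$, let $N\ge1$, and let $-1=x_0<x_1<\dots<x_N=1$. Then the primitive sampling matrix $\Psi_N\in\mathbb{R}^{(N+1)\times N}$ admits the decomposition $$\Psi_N=R_N+I_N^{\mathrm{ext}}\,T_N^{(J)},$$ where $R_N\in\mathbb{R}^{(N+1)\times N}$, $I_N^{\mathrm{ext}}\in\mathbb{R}^{(N+1)\times(N+2)}$ and the banded matrix $T_N^{(J)}\in\mathbb{R}^{(N+2)\times N}$ are defined in the context.
   Context: For $\alpha,\beta>-1$, $\omega_{\alpha,\beta}(t)=(1-t)^\alpha(1+t)^\beta$ on $[-1,1]$, and $P_j^{(\alpha,\beta)}$ is the Jacobi polynomial of degree $j$, orthogonal on $[-1,1]$ with respect to $\omega_{\alpha,\beta}$, with the standard normalization $P_j^{(\alpha,\beta)}(1)=\frac{\Gamma(j+\alpha+1)}{\Gamma(j+1)\Gamma(\alpha+1)}$. Primitive sampling matrix: $[\Psi_N]_{k,j}=\psi_j(x_k)$, $k=0,\dots,N$, $j=1,\dots,N$, where $\psi_j(x)=\int_{-1}^xP^{(\alpha+1,\beta+1)}_{j-1}(t)\,\omega_{\alpha,\beta}(t)\,dt$. $[I_N^{\mathrm{ext}}]_{k+1,r+1}=I_r(x_k)$ for $k=0,\dots,N$, $r=0,\dots,N+1$, where $I_r(x)=\int_{-1}^xP_r^{(\alpha,\beta)}(t)\,\omega_{\alpha-1,\beta-1}(t)\,dt$. $[R_N]_{k+1,j}=\widetilde r_j(x_k)$ for $k=0,\dots,N$, $j=1,\dots,N$,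 where $\widetilde r_j(x)=\frac{2}{j+\alpha+\beta+1}P_j^{(\alpha,\beta)}(x)\,\omega_{\alpha,\beta}(x)$. $T_N^{(J)}$ has as its only nonzero entries $[T_N^{(J)}]_{j,j}=\ell_j$, $[T_N^{(J)}]_{j+1,j}=d_j$, $[T_N^{(J)}]_{j+2,j}=u_j$, $j=1,\dots,N$, with $$u_j=\frac{2(\alpha+\beta)a_j}{j+\alpha+\beta+1},\quad d_j=\frac{2((\alpha-\beta)+(\alpha+\beta)b_j)}{j+\alpha+\beta+1},\quad \ell_j=\frac{2(\alpha+\beta)c_j}{j+\alpha+\beta+1},$$ and $$a_j=\frac{2(j+1)(j+\alpha+\beta+1)}{(2j+\alpha+\beta+1)(2j+\alpha+\beta+2)},\quad b_j=\frac{\beta^2-\alpha^2}{(2j+\alpha+\beta)(2j+\alpha+\beta+2)},\quad c_j=\frac{2(j+\alpha)(j+\beta)}{(2j+\alpha+\beta)(2j+\alpha+\beta+1)}.$$ *)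

(* Defs.v *)
From HB Require Import structures.
From mathcomp Require Import all_boot all_order all_algebra.
From mathcomp Require Import all_classical all_reals all_analysis.
Set Implicit Arguments.
Unset Strict Implicit.
Unset Printing Implicit Defensive.
Import Order.TTheory GRing.Theory Num.Theory.
Import numFieldNormedType.Exports.
Local Open Scope classical_set_scope.
Local Open Scope ring_scope.

Section Definitions.
Context {R : realType}.
Implicit Types (a b z x t : R) (j r N : nat).

(* All integrals are Lebesgue integrals. *)
Local Notation mu := (@lebesgue_measure R).

(* Euler's integral; it represents the Gamma function for 0 < z only. *)
Definition Gamma z : R :=
  \int[mu]_(t in `[0, +oo[) (t `^ (z - 1) * expR (- t)).

(* When an exponent is negative, the totalized power has the value 0 at the
   corresponding endpoint instead of +oo; such points are negligible for the
   integrals below. *)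
Definition jweight a b t : R := (1 - t) `^ a * (1 + t) `^ b.

Definition jacobi_system a b (P : nat -> {poly R}) : Prop :=
  [/\ forall j, size (P j) = j.+1,
      forall i j, i != j ->
        \int[mu]_(t in `[-1, 1]) ((P i).[t] * (P j).[t] * jweight a b t) = 0
    & forall j, (P j).[1] =
        Gamma (j%:R + a + 1) / (Gamma (j%:R + 1) * Gamma (a + 1))].

(* The system is unique when -1 < a and -1 < b; it is a junk value when no
   system exists. *)
Definition jacobi a b : nat -> {poly R} :=
  xget (fun=> 0) [set P | jacobi_system a b P].

Definition jac_psi a b j x : R :=
  \int[mu]_(t in `[-1, x])
    ((jacobi (a + 1) (b + 1) j.-1).[t] * jweight a b t).

Definition jac_I a b r x : R :=
  \int[mu]_(t in `[-1, x])
    ((jacobi a b r).[t] * jweight (a - 1) (b - 1) t).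

Definition jac_r a b j x : R :=
  2 / (j%:R + a + b + 1) * (jacobi a b j).[x] * jweight a b x.

Definition rec_a a b j : R :=
  2 * (j%:R + 1) * (j%:R + a + b + 1) /
  ((2 * j%:R + a + b + 1) * (2 * j%:R + a + b + 2)).

Definition rec_b a b j : R :=
  (b ^+ 2 - a ^+ 2) / ((2 * j%:R + a + b) * (2 * j%:R + a + b + 2)).

Definition rec_c a b j : R :=
  2 * (j%:R + a) * (j%:R + b) /
  ((2 * j%:R + a + b) * (2 * j%:R + a + b + 1)).

Definition coef_u a b j : R :=
  2 * (a + b) * rec_a a b j / (j%:R + a + b + 1).

Definition coef_d a b j : R :=
  2 * ((a - b) + (a + b) * rec_b a b j) / (j%:R + a + b + 1).

Definition coef_l a b j : R :=
  2 * (a + b) * rec_c a b j / (j%:R + a + b + 1).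

(* Ordinals start at 0 where j = 1, ..., N, so column j : 'I_N below carries
   the mathematical index j.+1; the indices k = 0, ..., N of the nodes and
   r = 0, ..., N + 1 of the functions I_r are unshifted. *)

Definition Psi_mx a b N (x : 'I_N.+1 -> R) : 'M[R]_(N.+1, N) :=
  \matrix_(k, j) jac_psi a b j.+1 (x k).

Definition R_mx a b N (x : 'I_N.+1 -> R) : 'M[R]_(N.+1, N) :=
  \matrix_(k, j) jac_r a b j.+1 (x k).

Definition Iext_mx a b N (x : 'I_N.+1 -> R) : 'M[R]_(N.+1, N.+2) :=
  \matrix_(k, r) jac_I a b r (x k).

Definition TJ_mx a b N : 'M[R]_(N.+2, N) :=
  \matrix_(i, j)
    if (i == j :> nat) then coef_l a b j.+1
    else if (i == j.+1 :> nat) then coef_d a b j.+1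
    else if (i == j.+2 :> nat) then coef_u a b j.+1
    else 0.

End Definitions.

(* Main.v *)
Require Import Defs.
From mathcomp Require Import all_boot all_order all_algebra.
From mathcomp Require Import all_classical all_reals all_analysis.
From mathcomp Require Import measurable_realfun ring lra.
Set Implicit Arguments.
Unset Strict Implicit.
Unset Printing Implicit Defensive.
Import Order.TTheory GRing.Theory Num.Theory.
Import numFieldNormedType.Exports.
Local Open Scope classical_set_scope.
Local Open Scope ring_scope.

(** Write w_(a, b) for the weight (1 - t)^a (1 + t)^b and P_j for the Jacobi
polynomials with parameters alpha, beta.  Entrywise, the decomposition is the
integral over [-1, x] of the product rule

  (P_j w_(alpha, beta))' = P_j' w_(alpha, beta)
     + (beta (1 - t) - alpha (1 + t)) P_j w_(alpha - 1, beta - 1).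

The boundary term at -1 vanishes because beta > 0.  The derivative P_j' is
(j + alpha + beta + 1) / 2 times the Jacobi polynomial of degree j - 1 with
parameters alpha + 1, beta + 1, so the first term on the right gives psi_j; in
the second one, the factor (beta - alpha) - (alpha + beta) t multiplies P_j, and
the three-term recurrence for t P_j turns it into a combination of P_(j-1), P_j,
P_(j+1), whose integrals are I_(j-1), I_j, I_(j+1)
([jac_psi_decomposition]).

Three ingredients make this rigorous.

- The polynomials are given only by their degree, their orthogonality and their
  value at 1, so they have to be identified.  The terminating hypergeometric sum
  in u = (1 - x) / 2 ([jacobi_poly]) has explicit coefficients, and comparing
  coefficients yields its derivative, three-term recurrence and differential
  equation.  The latter is of Sturm-Liouville type, so polynomials of different
  degrees are orthogonal ([jacobi_poly_ortho]); since an orthogonal system with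
  one polynomial of each degree is unique up to scalars and both systems agree at
  1, they coincide ([jacobiE]).

- The value at 1 is a quotient of Gamma values, which is evaluated by means of
  the functional equation and the positivity of the Gamma integral on z >= 1
  ([GammaD1], [Gamma_gt0], [Gamma_ratio]).

- When alpha or beta is below 1, the weight w_(alpha - 1, beta - 1) is unbounded.
  It is nevertheless integrable ([integrable_poly_jweight]), and the fundamental
  theorem of calculus holds for integrands that are integrable on the closed
  interval and continuous on the open one ([Rintegral_FTC_oo]).  The resulting
  formula [Rintegral_jweight_derivative] serves twice: for the product rule
  above, and, with alpha + 1, beta + 1, x = 1 and a Wronskian as polynomial, for
  the orthogonality. *)

(** * Coefficients of the Jacobi polynomials *)

Section JacobiCoefficients.
Context {R : realType}.
Implicit Types (a b x : R) (n k : nat).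

Definition pochhammer x k : R := \prod_(i < k) (x + i%:R).

Lemma pochhammerS x k : pochhammer x k.+1 = pochhammer x k * (x + k%:R).
Proof. by rewrite /pochhammer big_ord_recr. Qed.

Lemma pochhammer_shift x k :
  pochhammer x k * (x + k%:R) = x * pochhammer (x + 1) k.
Proof.
rewrite -pochhammerS /pochhammer big_ord_recl /= addr0; congr (_ * _).
by apply: eq_bigr => i _; rewrite /bump /= natrD addrA.
Qed.

Lemma pochhammer_gt0 x k : 0 < x -> 0 < pochhammer x k.
Proof. by move=> x0; apply: prodr_gt0 => i _; rewrite ltr_wpDr. Qed.

(** The coefficient of u^k in the hypergeometric series
(a + 1)_n / n! 2F1(-n, n + a + b + 1; a + 1; u), which is P_n^(a, b)(1 - 2u). *)
Definition jacobi_coef a b n k : R :=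
  pochhammer (a + 1) n / n`!%:R *
  (pochhammer (- n%:R) k * pochhammer (n%:R + a + b + 1) k /
   (pochhammer (a + 1) k * k`!%:R)).

(** Moving k to k + 1 multiplies a hypergeometric term by a rational function;
this ratio is the coefficientwise form of the differential equation. *)
Lemma jacobi_coef_recr a b n k : -1 < a ->
  k.+1%:R * (k%:R + a + 1) * jacobi_coef a b n k.+1 =
  (k%:R - n%:R) * (k%:R + n%:R + a + b + 1) * jacobi_coef a b n k.
Proof.
move=> a1; have k0 := ler0n R k; have n0 := ler0n R n.
rewrite /jacobi_coef !pochhammerS factS natrM.
have h1 : pochhammer (a + 1) k != 0.
  by rewrite gt_eqF// pochhammer_gt0//; lra.
have h2 : k`!%:R != 0 :> R by rewrite pnatr_eq0 -lt0n fact_gt0.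
have h3 : n`!%:R != 0 :> R by rewrite pnatr_eq0 -lt0n fact_gt0.
have h4 : a + 1 + k%:R != 0 by rewrite gt_eqF//; lra.
have h5 : 1 + k%:R != 0 :> R by rewrite gt_eqF//; lra.
by field; rewrite h1 h2 h3 h4 h5.
Qed.

(** Moving n to n + 1 also has a rational ratio.  It is stated without division
so that it remains true at k = n + 1, where the left-hand factor vanishes. *)
Lemma jacobi_coef_recl a b n k : -1 < a ->
  (n.+1%:R - k%:R) * (n%:R + a + b + 1) * jacobi_coef a b n.+1 k =
  (n%:R + a + 1) * (n%:R + k%:R + a + b + 1) * jacobi_coef a b n k.
Proof.
move=> a1; have k0 := ler0n R k; have n0 := ler0n R n.
rewrite /jacobi_coef pochhammerS factS natrM.
have h1 : pochhammer (a + 1) k != 0.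
  by rewrite gt_eqF// pochhammer_gt0//; lra.
have h2 : k`!%:R != 0 :> R by rewrite pnatr_eq0 -lt0n fact_gt0.
have h3 : n`!%:R != 0 :> R by rewrite pnatr_eq0 -lt0n fact_gt0.
have h5 : 1 + n%:R != 0 :> R by rewrite gt_eqF//; lra.
have e1 := pochhammer_shift (- n.+1%:R) k.
rewrite -[n.+1%:R]nat1r in e1.
rewrite (_ : - (1 + n%:R) + 1 = - n%:R) in e1; last by ring.
have e2 := pochhammer_shift (n%:R + a + b + 1) k.
rewrite (_ : n%:R + a + b + 1 + 1 = 1 + n%:R + a + b + 1) in e2; last by ring.
rewrite -nat1r.
transitivity ((pochhammer (a + 1) n * (a + 1 + n%:R)) / ((1 + n%:R) * n`!%:R)
   / (pochhammer (a + 1) k * k`!%:R) * - (pochhammer (- (1 + n%:R)) k *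
   (- (1 + n%:R) + k%:R)) * ((n%:R + a + b + 1) * pochhammer (1 + n%:R + a + b + 1) k)).
  by field; rewrite h1 h2 h3 h5.
rewrite e1 -e2.
by field; rewrite h1 h2 h3 h5.
Qed.


Lemma jacobi_coef0 a b n : jacobi_coef a b n 0 = pochhammer (a + 1) n / n`!%:R.
Proof. by rewrite /jacobi_coef /pochhammer !big_ord0 fact0 !mul1r invr1 mulr1. Qed.

Lemma pochhammer_opp_eq0 n k : (n < k)%N -> pochhammer (- n%:R) k = 0.
Proof.
by move=> nk; rewrite /pochhammer (bigD1 (Ordinal nk))//= addNr mul0r.
Qed.

Lemma pochhammer_opp_neq0 n : pochhammer (- n%:R) n != 0.
Proof.
rewrite /pochhammer prodf_seq_neq0; apply/allP => i _ /=.
by rewrite addrC subr_eq0 eqr_nat ltn_eqF.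
Qed.

Lemma jacobi_coef_eq0 a b n k : (n < k)%N -> jacobi_coef a b n k = 0.
Proof.
by move=> nk; rewrite /jacobi_coef pochhammer_opp_eq0// !mul0r mulr0.
Qed.

Lemma jacobi_coef_neq0 a b n : 0 < a -> 0 < b -> jacobi_coef a b n n != 0.
Proof.
move=> a0 b0; have n0 := ler0n R n; rewrite /jacobi_coef.
have h1 : pochhammer (a + 1) n != 0.
  by rewrite gt_eqF// pochhammer_gt0//; lra.
have h2 : n`!%:R != 0 :> R by rewrite pnatr_eq0 -lt0n fact_gt0.
have h3 : pochhammer (n%:R + a + b + 1) n != 0.
  by rewrite gt_eqF// pochhammer_gt0//; lra.
by rewrite !mulf_neq0 ?invr_neq0 ?mulf_neq0 ?pochhammer_opp_neq0.
Qed.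

(** Coefficient of u^0 of the three-term recurrence, with t = 1 - 2u. *)
Lemma three_term_coef0 a b n : 0 < a -> 0 < b ->
  (1 - rec_b a b n.+1) * jacobi_coef a b n.+1 0 =
  rec_a a b n.+1 * jacobi_coef a b n.+2 0 + rec_c a b n.+1 * jacobi_coef a b n 0.
Proof.
move=> a0 b0; have n0 := ler0n R n.
rewrite !jacobi_coef0 /rec_a /rec_b /rec_c !pochhammerS !factS !natrM.
rewrite -[n.+2%:R]nat1r -[n.+1%:R]nat1r.
have h1 : n`!%:R != 0 :> R by rewrite pnatr_eq0 -lt0n fact_gt0.
by field; rewrite h1 !gt_eqF//=; lra.
Qed.

(** Coefficient of u^(k + 1) of the three-term recurrence: for k <= n + 1 both
ratios above express every term by a single coefficient, which leaves an
identity of rational functions; for larger k all terms are 0. *)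
Lemma three_term_coefS a b n k : 0 < a -> 0 < b ->
  (1 - rec_b a b n.+1) * jacobi_coef a b n.+1 k.+1
   - 2 * jacobi_coef a b n.+1 k =
  rec_a a b n.+1 * jacobi_coef a b n.+2 k.+1
   + rec_c a b n.+1 * jacobi_coef a b n k.+1.
Proof.
move=> a0 b0; have n0 := ler0n R n; have k0 := ler0n R k.
have a1 : -1 < a by lra.
have up m : jacobi_coef a b m k.+1 =
    (k%:R - m%:R) * (k%:R + m%:R + a + b + 1) /
    ((k%:R + 1) * (k%:R + a + 1)) * jacobi_coef a b m k.
  apply: (@mulfI _ (k.+1%:R * (k%:R + a + 1))).
    by rewrite -natr1 gt_eqF// mulr_gt0//; lra.
  rewrite jacobi_coef_recr// -[k.+1%:R]natr1.
  by field; rewrite !gt_eqF//; lra.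
have right m : (k <= m)%N -> jacobi_coef a b m.+1 k =
   (m%:R + a + 1) * (m%:R + k%:R + a + b + 1) * jacobi_coef a b m k /
   ((m%:R + 1 - k%:R) * (m%:R + a + b + 1)).
  move=> km; have km' : k%:R <= m%:R :> R by rewrite ler_nat.
  have m0 := ler0n R m.
  rewrite -jacobi_coef_recl// -[m.+1%:R]natr1.
  by field; rewrite !gt_eqF//=; lra.
have [kn|] := leqP k n.
  have kn' : k%:R <= n%:R :> R by rewrite ler_nat.
  rewrite !up right ?leqW// [in RHS]right ?leqW// right// /rec_a /rec_b /rec_c.
  rewrite -[n.+2%:R]natr1 -[n.+1%:R]natr1.
  by field; rewrite !gt_eqF//=; lra.
rewrite leq_eqVlt => /predU1P[nk|nk].
  subst k; rewrite !up [jacobi_coef _ _ n _]jacobi_coef_eq0// (right n.+1)// /rec_a.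
  rewrite -[n.+2%:R]natr1 -[n.+1%:R]natr1.
  by field; rewrite !gt_eqF//=; lra.
have nk1 : (n < k.+1)%N by exact: leqW (ltnW nk).
by rewrite !jacobi_coef_eq0 ?ltnS ?(ltnW nk)// !mulr0 subr0 addr0.
Qed.

Lemma jacobi_coef_deriv a b n k : 0 < a -> 0 < b ->
  k.+1%:R * jacobi_coef a b n.+1 k.+1 =
  - (n.+1%:R + a + b + 1) * jacobi_coef (a + 1) (b + 1) n k.
Proof.
move=> a0 b0; have n0 := ler0n R n; have k0 := ler0n R k.
have h1 : pochhammer (a + 1 + 1) k != 0.
  by rewrite gt_eqF// pochhammer_gt0//; lra.
have h2 : k`!%:R != 0 :> R by rewrite pnatr_eq0 -lt0n fact_gt0.
have h3 : n`!%:R != 0 :> R by rewrite pnatr_eq0 -lt0n fact_gt0.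
rewrite /jacobi_coef ![pochhammer _ _.+1]pochhammerS !pochhammer_shift.
rewrite !factS !natrM -[k.+1%:R]natr1 -[n.+1%:R]natr1.
rewrite (_ : - (n%:R + 1) + 1 = - n%:R); last by ring.
rewrite (_ : n%:R + 1 + a + b + 1 + 1 = n%:R + (a + 1) + (b + 1) + 1); last by ring.
by field; rewrite h1 h2 h3 !gt_eqF//=; lra.
Qed.

End JacobiCoefficients.

(** * Jacobi polynomials as hypergeometric sums *)

Section JacobiPolynomial.
Context {R : realType}.
Implicit Types (a b x : R) (n k : nat).

(** The Jacobi polynomial as a polynomial in u = (1 - x) / 2. *)
Definition jacobi_half a b n : {poly R} := \poly_(k < n.+1) jacobi_coef a b n k.

Lemma coef_jacobi_half a b n k : (jacobi_half a b n)`_k = jacobi_coef a b n k.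
Proof. by rewrite coef_poly; case: ltnP => // nk; rewrite jacobi_coef_eq0. Qed.

Lemma coef_derivM (p : {poly R}) k : p^`()`_k = k.+1%:R * p`_k.+1.
Proof. by rewrite coef_deriv mulr_natl. Qed.

(** The hypergeometric equation with parameters -n, n + a + b + 1 and a + 1. *)
Lemma jacobi_half_ode a b n : -1 < a ->
  'X * (1 - 'X) * (jacobi_half a b n)^`()^`() +
  ((a + 1)%:P - (a + b + 2)%:P * 'X) * (jacobi_half a b n)^`() +
  (n%:R * (n%:R + a + b + 1))%:P * jacobi_half a b n = 0.
Proof.
move=> a1; apply/polyP => k.
rewrite !mulrBl !mulrBr mulr1 !mulrBl -!mulrA.
rewrite !(coefD, coefN, coefCM, coefXM, coef0, coef_derivM).
case: k => [|k]; last case: k => [|k]; rewrite /= !coef_jacobi_half.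
- by have := jacobi_coef_recr b n 0 a1 => e; lra.
- by have := jacobi_coef_recr b n 1 a1 => e; lra.
have := jacobi_coef_recr b n k.+2 a1; rewrite -[k.+3%:R]natr1 -[k.+2%:R]natr1 -[k.+1%:R]natr1 => e; lra.
Qed.

Lemma jacobi_half_deriv a b n : 0 < a -> 0 < b ->
  (jacobi_half a b n.+1)^`() =
  - (n.+1%:R + a + b + 1) *: jacobi_half (a + 1) (b + 1) n.
Proof.
move=> a0 b0; apply/polyP => k.
by rewrite coef_derivM coefZ !coef_jacobi_half jacobi_coef_deriv.
Qed.

Lemma jacobi_half_three_term a b n : 0 < a -> 0 < b ->
  (1 - 2 *: 'X) * jacobi_half a b n.+1 =
  rec_a a b n.+1 *: jacobi_half a b n.+2 + rec_b a b n.+1 *: jacobi_half a b n.+1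
  + rec_c a b n.+1 *: jacobi_half a b n.
Proof.
move=> a0 b0; apply/polyP => k.
rewrite mulrBl mul1r -scalerAl !(coefD, coefN, coefZ, coefXM) !coef_jacobi_half.
case: k => [|k] /=.
  by have := three_term_coef0 n a0 b0; lra.
by have := three_term_coefS n k a0 b0; lra.
Qed.

Definition jacobi_poly a b n : {poly R} :=
  jacobi_half a b n \Po (2^-1 *: (1 - 'X)).

Lemma comp_deriv_half (p : {poly R}) :
  (p \Po (2^-1 *: (1 - 'X)))^`() = - 2^-1 *: (p^`() \Po (2^-1 *: (1 - 'X))).
Proof.
rewrite deriv_comp derivZ derivB derivX derivC sub0r mulrC -scalerAl mulN1r.
by rewrite scalerN scaleNr.
Qed.

Lemma jacobi_polyE1 a b n : (jacobi_poly a b n).[1] = pochhammer (a + 1) n / n`!%:R.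
Proof.
rewrite /jacobi_poly horner_comp !hornerE subrr mulr0 horner_coef0.
by rewrite coef_jacobi_half jacobi_coef0.
Qed.

Lemma size_jacobi_poly a b n : 0 < a -> 0 < b -> size (jacobi_poly a b n) = n.+1.
Proof.
move=> a0 b0; rewrite /jacobi_poly size_comp_poly2.
  by rewrite size_poly_eq// jacobi_coef_neq0.
rewrite size_scale ?invr_eq0 ?pnatr_eq0// -opprB size_polyN.
exact: size_XsubC.
Qed.

Lemma jacobi_poly_deriv a b n : 0 < a -> 0 < b ->
  (jacobi_poly a b n.+1)^`() =
  ((n.+1%:R + a + b + 1) / 2) *: jacobi_poly (a + 1) (b + 1) n.
Proof.
move=> a0 b0; rewrite comp_deriv_half jacobi_half_deriv// comp_polyZ scalerA.
by congr (_ *: _); lra.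
Qed.

Lemma jacobi_poly_three_term a b n : 0 < a -> 0 < b ->
  'X * jacobi_poly a b n.+1 =
  rec_a a b n.+1 *: jacobi_poly a b n.+2 + rec_b a b n.+1 *: jacobi_poly a b n.+1
  + rec_c a b n.+1 *: jacobi_poly a b n.
Proof.
move=> a0 b0; rewrite -!comp_polyZ -!comp_polyD -jacobi_half_three_term//.
rewrite comp_polyM; congr (_ * _).
rewrite comp_polyB comp_polyZ comp_polyX scalerA divff ?pnatr_eq0// scale1r.
by rewrite comp_polyC subKr.
Qed.

(** Multiplied by the weight w_(a, b), the left-hand side is the derivative of
w_(a + 1, b + 1) J', so this is a Sturm-Liouville eigenvalue equation; it is the
hypergeometric equation in the variable u. *)
Lemma jacobi_poly_ode a b n : -1 < a ->
  (1 - 'X ^+ 2) * (jacobi_poly a b n)^`()^`() +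
  ((b + 1) *: (1 - 'X) - (a + 1) *: (1 + 'X)) * (jacobi_poly a b n)^`() =
  - (n%:R * (n%:R + a + b + 1)) *: jacobi_poly a b n.
Proof.
move=> a1; have := congr1 (fun p => p \Po (2^-1 *: (1 - 'X))) (jacobi_half_ode b n a1).
rewrite comp_poly0 !comp_polyD !comp_polyM !comp_polyB !comp_polyM !comp_polyX.
rewrite !comp_polyC -/(jacobi_poly a b n) => e.
rewrite comp_deriv_half derivZ comp_deriv_half scalerA mulrNN.
move: e; set V := 2^-1 *: (1 - 'X).
set P0 := jacobi_poly a b n; set P2 := _ \Po V; set P1 := _ \Po V => e.
(* Doubling and quadrupling the derivatives clears the denominators that the
   chain rule introduces, so that the identity holds over the integers. *)
have XV : 'X = 1 - 2%:R * V :> {poly R}.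
  by rewrite mulr_natl -scaler_nat scalerA divff ?pnatr_eq0// scale1r subKr.
have P1E : P1 = 2%:R * (2^-1 *: P1).
  by rewrite mulr_natl -scaler_nat scalerA divff ?pnatr_eq0// scale1r.
have P2E : P2 = 4%:R * ((2^-1 * 2^-1) *: P2).
  rewrite mulr_natl -scaler_nat scalerA -invfM -natrM divff ?pnatr_eq0//.
  by rewrite scale1r.
move: e; rewrite {1}P1E {1}P2E scaleNr mulrN XV.
move: (2^-1 *: P1) ((2^-1 * 2^-1) *: P2) => T1 T2 e.
apply/eqP; rewrite -subr_eq0; apply/eqP; rewrite -[RHS]e -!mul_polyC.
by rewrite !polyCN; ring.
Qed.
End JacobiPolynomial.

(** * The fundamental theorem of calculus on an open interval *)

Section ImproperFTC.
Context {R : realType}.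
Local Notation mu := (@lebesgue_measure R).
Implicit Types (f F : R -> R) (a b x : R).

(** The integral is continuous in its upper bound and has derivative f inside the
interval, so its difference with F is constant by the mean value theorem.  At the
endpoints f is controlled by integrability alone, so that weights with integrable
singularities are covered. *)
Lemma Rintegral_FTC_oo f F a b : a < b ->
  mu.-integrable `[a, b] (EFin \o f) ->
  {in `]a, b[, continuous f} ->
  (forall x, x \in `]a, b[ -> is_derive x 1 F (f x)) ->
  {within `[a, b], continuous F} ->
  forall x, x \in `[a, b] -> \int[mu]_(t in `[a, x]) f t = F x - F a.
Proof.
move=> ab intf cf dF cF x; rewrite in_itv/= => /andP[].
rewrite le_eqVlt => /predU1P[<- _|ax xb].
  by rewrite set_itv1 Rintegral_set1 subrr.
pose G y := \int[mu]_(t in `[a, y]) f t.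
have sub : `[a, x] `<=` `[a, b] by apply: subset_itvl; rewrite bnd_simp.
have cG : {within `[a, x], continuous G}.
  apply: continuous_subspaceW sub _.
  exact: (parameterized_integral_continuous (ltW ab) intf).
have dG y : y \in `]a, x[ -> is_derive y 1 G (f y).
  rewrite in_itv/= => /andP[ay yx]; have yb := lt_le_trans yx xb.
  have cy : {for y, continuous f} by apply: cf; rewrite in_itv/= ay yb.
  have [d1 d2] : derivable G y 1 /\ derive1 G y = f y.
    exact: (continuous_FTC1_closed yb intf ay cy).
  by apply: DeriveDef; [exact: d1|rewrite -derive1E d2].
have [| |] := @MVT _ (F \- G) (fun=> 0) a x ax.
- move=> y yax; have yab : y \in `]a, b[.
    by move: yax; rewrite !in_itv/= => /andP[-> /lt_le_trans ->].
  have := dF _ yab; have := dG _ yax => h1 h2.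
  by apply: is_derive_eq; rewrite subrr.
- move=> y; apply: continuousB; last exact: cG.
  exact: (continuous_subspaceW sub cF).
- move=> c _ /=; rewrite mul0r /G set_itv1 Rintegral_set1 subr0 => e.
  lra.
Qed.

(** A nonnegative derivative has integral at most F b - F a over every compact
subinterval, and monotone convergence carries this bound to the whole interval. *)
Lemma integrable_ge0_derivative f F a b : a < b ->
  {in `]a, b[, continuous f} ->
  (forall x, x \in `]a, b[ -> 0 <= f x) ->
  (forall x, x \in `]a, b[ -> is_derive x 1 F (f x)) ->
  {within `[a, b], continuous F} ->
  mu.-integrable `[a, b] (EFin \o f).
Proof.
move=> ab cf f0 dF cF.
have mfoo : measurable_fun `]a, b[ f.
  apply: open_continuous_measurable_fun => //.
  by move=> x /set_mem; exact: cf.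
have mf : measurable_fun `[a, b] f by exact: measurable_fun_itv_cc mfoo.
apply/integrableP; split; first exact/measurable_EFinP.
rewrite (@integral_itv_bndoo _ a b _ true false); last first.
  by do 2 apply: measurableT_comp => //.
pose d n : R := (b - a) / n.+3%:R.
have d0 n : 0 < d n by rewrite divr_gt0// subr_gt0.
have d2 n : a + d n < b - d n.
  have : d n + d n < b - a.
    rewrite /d -mulrDl ltr_pdivrMr// -mulr2n -[_ *+ 2]mulr_natr ltr_pM2l ?subr_gt0//.
    by rewrite ltr_nat.
  lra.
pose E n := `[a + d n, b - d n]%classic.
have nndE : nondecreasing_seq E.
  move=> m n mn; apply/subsetPset; apply: subset_itv; rewrite bnd_simp.
    rewrite lerD2l /d ler_pM2l ?subr_gt0// lef_pV2 ?posrE// ler_nat//.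
  rewrite lerD2l lerN2 /d ler_pM2l ?subr_gt0// lef_pV2 ?posrE// ler_nat//.
have sE n : E n `<=` `]a, b[.
  move=> x; rewrite /E /= !in_itv/= => /andP[h1 h2].
  by have := d0 n => ?; apply/andP; split; lra.
have UE : \bigcup_n E n = `]a, b[%classic.
  rewrite eqEsubset; split; first by apply: bigcup_sub => n _; exact: sE.
  move=> x; rewrite /= in_itv/= => /andP[ax xb].
  pose m := Num.min (x - a) (b - x).
  have m0 : 0 < m by rewrite lt_min !subr_gt0 ax xb.
  exists (Num.truncn ((b - a) / m)) => //.
  set n := Num.truncn _.
  have dm : d n <= m.
    rewrite /d ler_pdivrMr// -ler_pdivrMl// mulrC.
    rewrite (le_trans (ltW (truncnS_gt _)))// ler_nat -/n.
    by rewrite ltnW// ltnW.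
  move: dm; rewrite /m le_min => /andP[h1 h2].
  by rewrite /E /= in_itv/=; apply/andP; split; lra.
have mono : {in `[a, b]%R &, {homo F : x y / x <= y >-> x <= y}}.
  apply: ger0_derive1_le_cc cF => x xab.
    by have [] := dF _ xab.
  by rewrite derive1E; have [_ ->] := dF _ xab; exact: f0.
have bnd n : (\int[mu]_(x in E n) `|(f x)%:E| <= (F b - F a)%:E)%E.
  have h1 : a \in `[a, b] by rewrite in_itv/= lexx ltW.
  have h2 : b \in `[a, b] by rewrite in_itv/= lexx ltW.
  have h3 : a + d n \in `[a, b].
    by have := d0 n; have := d2 n; rewrite in_itv/= => ? ?; apply/andP; split; lra.
  have h4 : b - d n \in `[a, b].
    by have := d0 n; have := d2 n; rewrite in_itv/= => ? ?; apply/andP; split; lra.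
  have -> : (\int[mu]_(x in E n) `|(f x)%:E| = \int[mu]_(x in E n) (f x)%:E)%E.
    apply: eq_integral => x /set_mem /sE xab.
    by rewrite /= ger0_norm// f0.
  have cE : {within E n, continuous f}.
    apply: (@continuous_subspaceW _ _ _ `]a, b[); first exact: sE.
    by rewrite continuous_open_subspace//; move=> x /set_mem; exact: cf.
  have intE : mu.-integrable (E n) (EFin \o f).
    by apply: continuous_compact_integrable => //; exact: segment_compact.
  have FE : \int[mu]_(x in E n) f x = F (b - d n) - F (a + d n).
    have sE' x : x \in `](a + d n), (b - d n)[ -> x \in `]a, b[.
      by move=> xE; apply: (sE n); rewrite /E /=; exact: subset_itv_oo_cc.
    have xE : b - d n \in `[a + d n, b - d n] by rewrite in_itv/= lexx ltW.
    have cF' : {within `[a + d n, b - d n], continuous F}.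
      apply: continuous_subspaceW cF; apply: subset_trans (sE n) _.
      exact: subset_itv_oo_cc.
    have cfE : {in `](a + d n), (b - d n)[, continuous f}.
      by move=> x /sE'; exact: cf.
    have dFE x : x \in `](a + d n), (b - d n)[ -> is_derive x 1 F (f x).
      by move=> /sE'; exact: dF.
    exact: (Rintegral_FTC_oo (d2 n) intE cfE dFE cF' xE).
  have -> : (\int[mu]_(x in E n) (f x)%:E = (F (b - d n) - F (a + d n))%:E)%E.
    rewrite -FE /Rintegral fineK//.
    apply: (integrable_fin_num _ intE); exact: measurable_itv.
  rewrite lee_fin; apply: lerB; apply: mono => //.
    by rewrite gerBl ltW.
  by rewrite lerDl ltW.
have : (\int[mu]_(x in E i) `|(f x)%:E| @[i --> \oo] -->
    \int[mu]_(x in \bigcup_i E i) `|(f x)%:E|)%E.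
  apply: ge0_nondecreasing_set_cvg_integral => //; first by move=> n; exact: measurable_itv.
  move=> n; apply: measurableT_comp => //.
  by apply/measurable_EFinP; exact: measurable_funS (sE n) mfoo.
rewrite UE => cvgE.
apply: (@le_lt_trans _ _ (F b - F a)%:E); last exact: ltry.
by apply: cvge_to_le cvgE _; exact: nearW.
Qed.

End ImproperFTC.

(** * Integration against the Jacobi weight *)

Section JacobiWeight.
Context {R : realType}.
Local Notation mu := (@lebesgue_measure R).
Implicit Types (a b x t : R) (p q : {poly R}).

Lemma is_derive_continuous (f : R -> R) t df :
  is_derive t 1 f df -> {for t, continuous f}.
Proof.
by case=> df' _; apply: differentiable_continuous; exact/derivable1_diffP.
Qed.

(** Truncating at 0 extends the power continuously to the whole line; this makes
the weight agree on [-1, 1] with a function continuous everywhere. *)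
Lemma continuous_powR_max a : 0 <= a -> continuous (fun t => (Num.max t 0) `^ a).
Proof.
rewrite le_eqVlt => /predU1P[<- t|a0 t].
  rewrite (_ : (fun t : R => _) = cst 1); first exact: cvg_cst.
  by apply/funext => u; rewrite powRr0.
have [t0|t0|->] := ltgtP t 0.
- apply/(@cvgrPdist_lt _ R^o) => e e0; near=> s.
  rewrite !max_r ?subrr ?normr0// ltW//; near: s.
  exact: lt_nbhsl.
- suff : {for t, continuous ((@powR R) ^~ a)}.
    rewrite /prop_for /continuous_at max_l ?(ltW t0)//; apply: cvg_trans.
    apply: near_eq_cvg; near=> s; rewrite max_l// ltW//; near: s.
    exact: lt_nbhsr.
  exact: is_derive_continuous (is_derive1_powR a t0).
- apply/(@cvgrPdist_lt _ R^o) => e e0; near=> s.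
  rewrite maxxx powR0 ?gt_eqF// sub0r normrN ger0_norm ?powR_ge0//.
  have -> : e = (e `^ a^-1) `^ a by rewrite -powRrM mulVf ?gt_eqF// powRr1 ?ltW.
  apply: gt0_ltr_powR => //; rewrite ?nnegrE ?powR_ge0 ?le_max ?lexx ?orbT//.
  rewrite gt_max powR_gt0// andbT; near: s.
  by apply: lt_nbhsl; rewrite powR_gt0.
Unshelve. all: by end_near. Qed.

Lemma within_continuous_jweight a b : 0 <= a -> 0 <= b ->
  {within `[-1, 1], continuous (jweight a b)}.
Proof.
move=> a0 b0.
pose w t : R := (Num.max (1 - t) 0) `^ a * (Num.max (1 + t) 0) `^ b.
have cw : continuous w.
  move=> t; apply: cvgM.
    apply: (@continuous_comp _ _ _ (fun t : R => 1 - t) (fun t => (Num.max t 0) `^ a)).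
      by apply: cvgB; [exact: cvg_cst|exact: cvg_id].
    exact: continuous_powR_max.
  apply: (@continuous_comp _ _ _ (fun t : R => 1 + t) (fun t => (Num.max t 0) `^ b)).
    by apply: cvgD; [exact: cvg_cst|exact: cvg_id].
  exact: continuous_powR_max.
apply: (@subspace_eq_continuous _ _ _ w); last exact: continuous_subspaceT.
move=> t /set_mem/=; rewrite in_itv/= => /andP[h1 h2].
by rewrite /w /jweight/= !max_l//; lra.
Qed.

Lemma jweight_mul_onem2 a b t : 0 < a -> 0 < b -> t \in `[-1, 1] ->
  jweight a b t = (1 - t ^+ 2) * jweight (a - 1) (b - 1) t.
Proof.
move=> a0 b0; rewrite in_itv/= => /andP[h1 h2]; rewrite /jweight.
rewrite -(@mulr_powRB1 _ (1 - t) a)//; last by lra.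
rewrite -(@mulr_powRB1 _ (1 + t) b)//; last by lra.
ring.
Qed.

Lemma is_derive_powR_onem a t : t < 1 ->
  is_derive t 1 (fun t => (1 - t) `^ a) (- (a * (1 - t) `^ (a - 1))).
Proof.
move=> t1; have t0 : 0 < 1 - t by lra.
have h : is_derive t 1 (fun t : R => 1 - t) (-1 : R).
  by apply: is_derive_eq; ring.
have := @is_derive1_comp _ ((@powR R) ^~ a) (fun t => 1 - t) t _ _ (is_derive1_powR a t0) h.
by rewrite mulrN1.
Qed.

Lemma is_derive_powR_onep a t : -1 < t ->
  is_derive t 1 (fun t => (1 + t) `^ a) (a * (1 + t) `^ (a - 1)).
Proof.
move=> t1; have t0 : 0 < 1 + t by lra.
have h : is_derive t 1 (fun t : R => 1 + t) (1 : R).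
  by apply: is_derive_eq; ring.
have := @is_derive1_comp _ ((@powR R) ^~ a) (fun t => 1 + t) t _ _ (is_derive1_powR a t0) h.
by rewrite mulr1.
Qed.

(** The product rule, in which a factor of each power is absorbed so that the
derivative is again a polynomial times one weight. *)
Lemma is_derive_poly_jweight a b p t : 0 < a -> 0 < b -> t \in `]-1, 1[ ->
  is_derive t 1 (fun t => p.[t] * jweight a b t)
   (((1 - 'X ^+ 2) * p^`() + (b *: (1 - 'X) - a *: (1 + 'X)) * p).[t]
     * jweight (a - 1) (b - 1) t).
Proof.
move=> a0 b0 tI; have tI' : t \in `[-1, 1] by exact: subset_itv_oo_cc.
move: tI; rewrite in_itv/= => /andP[t1 t2].
have h1 := is_derive_powR_onem a t2.
have h2 := is_derive_powR_onep b t1.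
have h3 := is_derive_poly p t.
rewrite /jweight; apply: is_derive_eq.
have scE (u v : R) : u *: (v : R^o) = u * v by [].
rewrite !scE !hornerE /=.
rewrite -(@mulr_powRB1 _ (1 - t) a)//; last by lra.
rewrite -(@mulr_powRB1 _ (1 + t) b)//; last by lra.
ring.
Qed.

Lemma continuous_jweight a b t : t \in `]-1, 1[ -> {for t, continuous (jweight a b)}.
Proof.
rewrite in_itv/= => /andP[t1 t2].
have c1 := is_derive_continuous (is_derive_powR_onem a t2).
have c2 := is_derive_continuous (is_derive_powR_onep b t1).
exact: (cvgM c1 c2).
Qed.

Lemma integrable_powR_onep b : 0 < b ->
  mu.-integrable `[-1, 1] (EFin \o (fun t => (1 + t) `^ (b - 1))).
Proof.
move=> b0; apply: (@integrable_ge0_derivative _ _ (fun t => b^-1 * (1 + t) `^ b)).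
- lra.
- move=> t; rewrite in_itv/= => /andP[t1 _].
  exact: is_derive_continuous (is_derive_powR_onep (b - 1) t1).
- by move=> t _; exact: powR_ge0.
- move=> t; rewrite in_itv/= => /andP[t1 _].
  have h := is_derive_powR_onep b t1.
  apply: is_derive_eq.
  by rewrite -[LHS]/(b^-1 * (b * _)) mulrA mulVf ?gt_eqF// mul1r.
- have := @within_continuous_jweight 0 b (lexx 0) (ltW b0).
  move=> c t; apply: cvgMr; have := c t; rewrite /jweight.
  by under [fun t => _ * _]eq_fun do rewrite powRr0 mul1r.
Qed.

Lemma integrable_powR_onem a : 0 < a ->
  mu.-integrable `[-1, 1] (EFin \o (fun t => (1 - t) `^ (a - 1))).
Proof.
move=> a0; apply: (@integrable_ge0_derivative _ _ (fun t => - a^-1 * (1 - t) `^ a)).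
- lra.
- move=> t; rewrite in_itv/= => /andP[_ t1].
  exact: is_derive_continuous (is_derive_powR_onem (a - 1) t1).
- by move=> t _; exact: powR_ge0.
- move=> t; rewrite in_itv/= => /andP[_ t1].
  have h := is_derive_powR_onem a t1.
  apply: is_derive_eq.
  by rewrite -[LHS]/(- a^-1 * - (a * _)) mulrNN mulrA mulVf ?gt_eqF// mul1r.
- have := @within_continuous_jweight a 0 (ltW a0) (lexx 0).
  move=> c t; apply: cvgMr; have := c t; rewrite /jweight.
  by under [fun t => _ * _]eq_fun do rewrite powRr0 mulr1.
Qed.

Lemma horner_le_sum_coef p t : t \in `[-1, 1] ->
  `|p.[t]| <= \sum_(i < size p) `|p`_i|.
Proof.
rewrite in_itv/= -ler_norml => t1; rewrite horner_coef.
apply: le_trans (ler_norm_sum _ _ _) _; apply: ler_sum => i _.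
by rewrite normrM normrX ler_piMr// exprn_ile1.
Qed.

(** Twice the weight is ((1 - t) + (1 + t)) times the weight, and each summand
removes the singularity at one endpoint. *)
Lemma jweight_le_sum a b t : 0 < a -> 0 < b -> t \in `[-1, 1] ->
  jweight (a - 1) (b - 1) t <=
  2 `^ a * (1 + t) `^ (b - 1) + 2 `^ b * (1 - t) `^ (a - 1).
Proof.
move=> a0 b0; rewrite in_itv/= => /andP[h1 h2]; rewrite /jweight.
have e1 : (1 - t) `^ a <= 2 `^ a.
  by apply: ge0_ler_powR; rewrite ?nnegrE; lra.
have e2 : (1 + t) `^ b <= 2 `^ b.
  by apply: ge0_ler_powR; rewrite ?nnegrE; lra.
have u0 := powR_ge0 (1 - t) (a - 1); have v0 := powR_ge0 (1 + t) (b - 1).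
have := ler_wpM2r u0 e2; have := ler_wpM2r v0 e1.
rewrite -(@mulr_powRB1 _ (1 - t) a)//; last by lra.
rewrite -(@mulr_powRB1 _ (1 + t) b)//; last by lra.
have uv0 := mulr_ge0 u0 v0 => h3 h4; lra.
Qed.

Lemma integrable_poly_jweight a b p : 0 < a -> 0 < b ->
  mu.-integrable `[-1, 1] (EFin \o (fun t => p.[t] * jweight (a - 1) (b - 1) t)).
Proof.
move=> a0 b0; set M := \sum_(i < size p) `|p`_i|.
pose g t : R := 2 `^ a * (1 + t) `^ (b - 1) + 2 `^ b * (1 - t) `^ (a - 1).
have ig : mu.-integrable `[-1, 1] (EFin \o g).
  have -> : EFin \o g = ((fun t => (2 `^ a)%:E * ((1 + t) `^ (b - 1))%:E)
      \+ (fun t => (2 `^ b)%:E * ((1 - t) `^ (a - 1))%:E))%E.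
    by apply/funext => t; rewrite /= -!EFinM -EFinD.
  apply: integrableD => //; apply: integrableZl => //.
    exact: integrable_powR_onep.
  exact: integrable_powR_onem.
have iMg : mu.-integrable `[-1, 1] (fun t => M%:E * (EFin \o g) t)%E.
  by apply: integrableZl.
apply: le_integrable iMg => //.
  apply/measurable_EFinP; apply: measurable_funM; first exact: measurable_poly.
  apply: measurable_funTS; apply: measurable_funM.
    apply: (measurableT_comp (measurable_powR _)).
    by apply: measurable_funB.
  apply: (measurableT_comp (measurable_powR _)).
  by apply: measurable_funD.
move=> t tI; rewrite /= lee_fin (normrM p.[t]) (normrM M) ler_pM// ?normr_ge0//.
  by rewrite (le_trans (horner_le_sum_coef p tI))// ler_norm.
have j0 : 0 <= jweight (a - 1) (b - 1) t by rewrite mulr_ge0 ?powR_ge0.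
by rewrite (ger0_norm j0) (le_trans (jweight_le_sum a0 b0 tI))// ler_norm.
Qed.

(** The boundary term at -1 is 0 because b is positive. *)
Lemma Rintegral_jweight_derivative a b p x : 0 < a -> 0 < b -> x \in `[-1, 1] ->
  \int[mu]_(t in `[-1, x])
   (((1 - 'X ^+ 2) * p^`() + (b *: (1 - 'X) - a *: (1 + 'X)) * p).[t]
     * jweight (a - 1) (b - 1) t) = p.[x] * jweight a b x.
Proof.
move=> a0 b0 xI.
have lt11 : -1 < 1 :> R by lra.
have cq q : {in `]-1, 1[, continuous (fun t => q.[t] * jweight (a - 1) (b - 1) t)}.
  move=> t tI; apply: cvgM; first exact: continuous_horner.
  exact: continuous_jweight.
have cF : {within `[-1, 1], continuous (fun t => p.[t] * jweight a b t)}.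
  move=> t; apply: cvgM; last exact: within_continuous_jweight (ltW a0) (ltW b0) t.
  exact: (continuous_subspaceT (@continuous_horner _ p)).
have dF t tI := @is_derive_poly_jweight a b p t a0 b0 tI.
have := Rintegral_FTC_oo lt11 (integrable_poly_jweight _ a0 b0) (cq _) dF cF xI.
rewrite /= => ->.
by rewrite [X in _ - X](_ : _ = 0) ?subr0// /jweight subrr [0 `^ _]powR0 ?gt_eqF// !mulr0.
Qed.

End JacobiWeight.

(** * The Gamma function for z >= 1 *)

Section GammaFunction.
Context {R : realType}.
Local Notation mu := (@lebesgue_measure R).
Implicit Types (a c p t z : R) (n : nat).

Let g p t : R := t `^ p * expR (- t).
Let h t : R := expR (- (t / 2)).

Lemma scaleRE (u v : R) : u *: (v : R^o) = u * v.
Proof. by []. Qed.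

(** Half of the exponential decay absorbs the power: t / (2p) <= exp (t / (2p)),
raised to the power p. *)
Lemma powR_expR_le p t : 0 <= p -> 0 <= t -> g p t <= (2 * p) `^ p * h t.
Proof.
rewrite /g /h => p0 t0.
suff : t `^ p <= (2 * p) `^ p * expR (t / 2).
  move=> /(ler_wpM2r (expR_ge0 (- t))) /le_trans; apply.
  rewrite -mulrA -expRD ler_wpM2l ?powR_ge0// ler_expR; lra.
move: p0; rewrite le_eqVlt => /predU1P[<-|p0].
  by rewrite !powRr0 mul1r -expR0 ler_expR divr_ge0.
have p2 : 0 < 2 * p by rewrite mulr_gt0.
have u0 : 0 <= t / (2 * p) by rewrite divr_ge0// ltW.
have -> : t `^ p = (2 * p) `^ p * (t / (2 * p)) `^ p.
  by rewrite -powRM ?(ltW p2)//; congr (_ `^ _); field; rewrite gt_eqF.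
rewrite ler_wpM2l ?powR_ge0//.
have -> : expR (t / 2) = expR (t / (2 * p)) `^ p.
  by rewrite -expRM; congr expR; field; rewrite gt_eqF.
apply: ge0_ler_powR; rewrite ?nnegrE ?expR_ge0 ?(ltW p0)//.
by have := expR_ge1Dx (t / (2 * p)); lra.
Qed.

Lemma cvg_half_expR : h t @[t --> +oo] --> (0 : R).
Proof.
rewrite /h; apply: (@cvg_comp _ _ _ (fun t => t / 2) (fun t => expR (- t))); last exact: cvgr_expR.
by apply: gt0_cvgMly; [lra|exact: cvg_id].
Qed.

Lemma cvg_powR_expR p : 0 <= p -> g p t @[t --> +oo] --> (0 : R).
Proof.
move=> p0; apply: (@squeeze_cvgr _ _ _ _ (cst 0) (fun t => (2 * p) `^ p * h t)).
- near=> t; rewrite /cst mulr_ge0 ?powR_ge0 ?expR_ge0//=.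
  by apply: powR_expR_le => //; near: t; exact: nbhs_pinfty_ge.
- exact: cvg_cst.
- rewrite -[0](mulr0 ((2 * p) `^ p)); apply: cvgMr; exact: cvg_half_expR.
Unshelve. all: by end_near. Qed.

Lemma is_derive_half_expR t : is_derive t 1 h (- 2^-1 * h t).
Proof.
have d : is_derive t 1 (fun t : R => - (t / 2)) (- 2^-1 : R).
  by apply: is_derive_eq; rewrite ?scaleRE; ring.
have := @is_derive1_comp _ expR (fun t => - (t / 2)) t _ _ (is_derive_expR _) d.
by rewrite mulrC.
Qed.

Lemma is_derive_powR_expR p t : 0 < t ->
  is_derive t 1 (g p) (p * g (p - 1) t - g p t).
Proof.
move=> t0.
have d1 : is_derive t 1 (fun t : R => - t) (-1 : R) by apply: is_derive_eq.
have d2 := @is_derive1_comp _ expR (fun t => - t) t _ _ (is_derive_expR _) d1.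
have d3 := is_derive1_powR p t0.
apply: is_derive_eq; rewrite ?scaleRE /g /=; ring.
Qed.

Lemma within_continuous_powR_expR p : 0 <= p -> {within `[0, +oo[, continuous (g p)}.
Proof.
move=> p0; pose w t : R := (Num.max t 0) `^ p * expR (- t).
apply: (@subspace_eq_continuous _ _ _ w).
  move=> t /set_mem/=; rewrite in_itv/= andbT => t0.
  by rewrite /w /g max_l.
apply: continuous_subspaceT => t; apply: cvgM; first exact: continuous_powR_max.
apply: (@continuous_comp _ _ _ (fun t : R => - t) expR).
  exact: opp_continuous.
exact: continuous_expR.
Qed.

Lemma within_continuous_half_expR : {within `[0, +oo[, continuous h}.
Proof.
apply: continuous_subspaceT => t.
exact: is_derive_continuous (is_derive_half_expR t).
Qed.

Lemma integral_half_expR : (\int[mu]_(t in `[0%R, +oo[) (h t)%:E = 2%:E)%E.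
Proof.
rewrite (@ge0_continuous_FTC2y _ h (fun t => - 2 * h t) 0 (- 2 * 0)).
- by rewrite -EFinB /h mul0r oppr0 expR0; congr (_%:E); ring.
- by move=> t _; exact: expR_ge0.
- exact: within_continuous_half_expR.
- by apply: cvgMr; exact: cvg_half_expR.
- move=> t t0; have d := is_derive_half_expR t; exact: derivableM.
- apply: cvgMr; have /continuous_within_itvcyP[_] := within_continuous_half_expR.
  exact.
- move=> t _; rewrite derive1E; have d := is_derive_half_expR t.
  by rewrite derive_val scaleRE; field.
Qed.

Lemma integrable_half_expR : mu.-integrable `[0, +oo[ (EFin \o h).
Proof.
apply/integrableP; split.
  apply/measurable_EFinP; apply: subspace_continuous_measurable_fun => //.
  exact: within_continuous_half_expR.
under eq_integral do rewrite /= ger0_norm ?expR_ge0//.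
by rewrite integral_half_expR ltry.
Qed.

Lemma Rintegral_half_expR : \int[mu]_(t in `[0, +oo[) h t = 2.
Proof. by rewrite /Rintegral integral_half_expR. Qed.

Lemma integrable_scale (D : set R) (k : R) (f : R -> R) : measurable D ->
  mu.-integrable D (EFin \o f) -> mu.-integrable D (EFin \o (fun t => k * f t)).
Proof.
move=> mD fi; rewrite (_ : _ \o _ = (fun t => k%:E * (EFin \o f) t)%E).
  exact: integrableZl.
by apply/funext => t; rewrite /= EFinM.
Qed.

Lemma integrable_powR_expR p : 0 <= p -> mu.-integrable `[0, +oo[ (EFin \o g p).
Proof.
move=> p0.
have i1 : mu.-integrable `[0, +oo[ (fun t => ((2 * p) `^ p)%:E * (EFin \o h) t)%E.
  by apply: integrableZl => //; exact: integrable_half_expR.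
apply: le_integrable i1 => //.
  apply/measurable_EFinP; apply: subspace_continuous_measurable_fun => //.
  exact: within_continuous_powR_expR.
move=> t; rewrite /= in_itv/= andbT => t0.
rewrite lee_fin ger0_norm ?mulr_ge0 ?powR_ge0 ?expR_ge0//.
by rewrite (le_trans (powR_expR_le p0 t0))// ler_norm.
Qed.

(** Integrate the derivative of t^z exp(-t).  The fundamental theorem on the half
line is available for nonnegative integrands, so a multiple of exp(-t/2) that
dominates the negative term is added first; its integral cancels in the end. *)
Lemma GammaD1 z : 1 <= z -> Gamma (z + 1) = z * Gamma z.
Proof.
move=> z1; have z0 : 0 <= z by lra.
have z10 : 0 <= z - 1 by lra.
rewrite /Gamma addrK -/(g z) -/(g (z - 1)).
pose C := (2 * z) `^ z.
have e : \int[mu]_(t in `[0, +oo[) (C * h t - g z t + z * g (z - 1) t) = 2 * C.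
  rewrite (@Rintegral_ge0_continuous_FTC2y _ _ (fun t => - 2 * C * h t + g z t) 0 (- 2 * C * 0 + 0)).
  - rewrite /h /g mul0r oppr0 expR0 powR0 ?gt_eqF//; last by lra.
    ring.
  - move=> t t0; have := powR_expR_le z0 t0.
    have : 0 <= z * g (z - 1) t by rewrite mulr_ge0// mulr_ge0 ?powR_ge0 ?expR_ge0.
    by rewrite -/C => ? ?; lra.
  - move=> t; apply: cvgD; [apply: cvgB|].
    + by apply: cvgMr; exact: within_continuous_half_expR.
    + exact: within_continuous_powR_expR.
    + by apply: cvgMr; exact: within_continuous_powR_expR.
  - apply: cvgD; last exact: cvg_powR_expR.
    by apply: cvgMr; exact: cvg_half_expR.
  - move=> t t0; have d1 := is_derive_half_expR t.
    by have d2 := is_derive_powR_expR z t0; exact: ex_derive.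
  - have /continuous_within_itvcyP[_ c1] := within_continuous_half_expR.
    have /continuous_within_itvcyP[_ c2] := within_continuous_powR_expR z0.
    by apply: cvgD => //; apply: cvgMr.
  - move=> t; rewrite in_itv/= andbT => t0; rewrite derive1E.
    have d1 := is_derive_half_expR t.
    have d2 := is_derive_powR_expR z t0.
    by rewrite derive_val ?scaleRE; field.
have ih : mu.-integrable `[0, +oo[ (EFin \o (fun t => C * h t)).
  exact: integrable_scale integrable_half_expR.
have ig := integrable_powR_expR z0.
have ig1 : mu.-integrable `[0, +oo[ (EFin \o (fun t => z * g (z - 1) t)).
  exact: integrable_scale (integrable_powR_expR z10).
have ihg : mu.-integrable `[0, +oo[ (EFin \o (fun t => C * h t - g z t)).
  rewrite (_ : _ \o _ = (EFin \o (fun t => C * h t)%R) \- (EFin \o g z))%E.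
    exact: integrableB.
  by apply/funext => t; rewrite /= EFinB.
move: e; rewrite RintegralD// RintegralB// !RintegralZl//; first last.
- exact: integrable_half_expR.
- exact: integrable_powR_expR.
rewrite Rintegral_half_expR.
move: (\int[mu]_(x in _) g z x) (\int[mu]_(x in _) g (z - 1) x) => A B e; lra.
Qed.

Lemma Rintegral_expR_tail c : 0 <= c ->
  \int[mu]_(t in `[c, +oo[) g 0 t = expR (- c).
Proof.
move=> c0; have g0 t : g 0 t = expR (- t) by rewrite /g powRr0 mul1r.
have dg t : is_derive t 1 (fun t => - expR (- t)) (expR (- t)).
  have d1 : is_derive t 1 (fun t : R => - t) (-1 : R) by apply: is_derive_eq.
  have d2 := @is_derive1_comp _ expR (fun t => - t) t _ _ (is_derive_expR _) d1.
  by apply: is_derive_eq; rewrite /=; ring.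
rewrite (@Rintegral_ge0_continuous_FTC2y _ (g 0) (fun t => - expR (- t)) c (- 0)).
- by rewrite oppr0 opprK add0r.
- by move=> t _; rewrite g0 expR_ge0.
- apply: continuous_subspaceW (within_continuous_powR_expR (lexx 0)).
  by apply: subset_itvr; rewrite bnd_simp.
- by apply: cvgN; exact: cvgr_expR.
- by move=> t _; have := dg t => d; exact: ex_derive.
- apply: cvg_at_right_filter; exact: is_derive_continuous (dg c).
- by move=> t _; rewrite derive1E; have := dg t => d; rewrite derive_val g0.
Qed.

Lemma Gamma1 : Gamma 1 = 1 :> R.
Proof.
by rewrite /Gamma subrr -/(g 0) Rintegral_expR_tail// oppr0 expR0.
Qed.

(** On [1, +oo[ the integrand is at least exp(-t). *)
Lemma Gamma_gt0 z : 1 <= z -> 0 < Gamma z.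
Proof.
move=> z1; have z10 : 0 <= z - 1 by lra.
rewrite /Gamma -/(g (z - 1)).
have ig := integrable_powR_expR z10.
have s1 : `[1, +oo[ `<=` `[(0:R), +oo[ by apply: subset_itvr; rewrite bnd_simp.
have s2 : `]1, +oo[ `<=` `[(0:R), +oo[ by apply: subset_itvr; rewrite bnd_simp.
have e := Rintegral_expR_tail ler01.
have h1 : \int[mu]_(t in `[1, +oo[) g 0 t <= \int[mu]_(t in `[1, +oo[) g (z - 1) t.
  apply: le_Rintegral => //.
  - by apply: integrableS (integrable_powR_expR (lexx 0)).
  - by apply: integrableS ig.
  - move=> t; rewrite /= in_itv/= andbT => t1; rewrite /g ler_wpM2r ?expR_ge0//.
    exact: ler_powR.
have h2 := Rintegral_itvB ig (x := 1).
have h3 : 0 <= \int[mu]_(t in `[0, 1]) g (z - 1) t.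
  by apply: Rintegral_ge0 => t _; rewrite /g mulr_ge0 ?powR_ge0 ?expR_ge0.
move: h2; rewrite !bnd_simp => /(_ ler01 isT).
rewrite Rintegral_itv_obnd_cbnd; last by apply: integrableS ig.
move=> /eqP; rewrite subr_eq => /eqP ->.
by apply: ltr_wpDr => //; apply: lt_le_trans h1; rewrite e expR_gt0.
Qed.

Lemma GammaD_pochhammer z n : 1 <= z -> Gamma (n%:R + z) = pochhammer z n * Gamma z.
Proof.
move=> z1; elim: n => [|n IH].
  by rewrite /pochhammer big_ord0 add0r mul1r.
rewrite -natr1 addrAC GammaD1; last by rewrite (le_trans z1)// lerDr.
by rewrite IH pochhammerS addrC; ring.
Qed.

Lemma pochhammer1 n : pochhammer 1 n = n`!%:R :> R.
Proof.
elim: n => [|n IH]; first by rewrite /pochhammer big_ord0.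
by rewrite pochhammerS IH factS natrM nat1r mulrC.
Qed.

Lemma Gamma_ratio a n : 0 <= a ->
  Gamma (n%:R + a + 1) / (Gamma (n%:R + 1) * Gamma (a + 1)) =
  pochhammer (a + 1) n / n`!%:R.
Proof.
move=> a0; have a1 : 1 <= a + 1 by lra.
rewrite -addrA !GammaD_pochhammer// Gamma1 mulr1 pochhammer1.
by rewrite -mulf_div divff ?mulr1// gt_eqF// Gamma_gt0.
Qed.

End GammaFunction.

(** * Orthogonality and uniqueness *)

Section JacobiMoments.
Context {R : realType}.
Local Notation mu := (@lebesgue_measure R).
Implicit Types (a b x t c : R) (p q : {poly R}).

Definition jmoment a b x q : R := \int[mu]_(t in `[-1, x]) (q.[t] * jweight a b t).

Lemma integrable_jmoment a b x q : -1 < a -> -1 < b -> x \in `[-1, 1] ->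
  mu.-integrable `[-1, x] (EFin \o (fun t => q.[t] * jweight a b t)).
Proof.
rewrite in_itv/= => a1 b1 /andP[_ x1].
have a0 : 0 < a + 1 by lra.
have b0 : 0 < b + 1 by lra.
have := integrable_poly_jweight q a0 b0; rewrite !addrK => i1.
by apply: integrableS i1 => //; apply: subset_itvl; rewrite bnd_simp.
Qed.

Lemma jmomentD a b x p q : -1 < a -> -1 < b -> x \in `[-1, 1] ->
  jmoment a b x (p + q) = jmoment a b x p + jmoment a b x q.
Proof.
move=> a1 b1 xI; rewrite /jmoment -RintegralD//; last 2 first.
- exact: integrable_jmoment.
- exact: integrable_jmoment.
by apply: eq_Rintegral => t _; rewrite hornerD mulrDl.
Qed.

Lemma jmomentZ a b x c q : -1 < a -> -1 < b -> x \in `[-1, 1] ->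
  jmoment a b x (c *: q) = c * jmoment a b x q.
Proof.
move=> a1 b1 xI; have iq := integrable_jmoment q a1 b1 xI.
rewrite /jmoment -RintegralZl//.
by apply: eq_Rintegral => t _; rewrite hornerZ -mulrA.
Qed.

(** The integral over [-1, x] of a nonnegative function with total integral 0
vanishes for all x, hence so does its derivative q^2 w; the weight is positive
inside the interval, so q has infinitely many roots. *)
Lemma jmoment_sqr_eq0 a b q : -1 < a -> -1 < b ->
  jmoment a b 1 (q ^+ 2) = 0 -> q = 0.
Proof.
move=> a1 b1 q0.
pose f t := (q ^+ 2).[t] * jweight a b t.
have f0 t : 0 <= f t.
  rewrite /f horner_exp; apply: mulr_ge0; first exact: sqr_ge0.
  by rewrite mulr_ge0 ?powR_ge0.
have I1 : 1 \in `[(-1 : R), 1] by rewrite in_itv/=; apply/andP; split; lra.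
have int1 : mu.-integrable `[-1, 1] (EFin \o f) by exact: integrable_jmoment.
have F0 x : x \in `]-1, 1[ -> \int[mu]_(t in `[-1, x]) f t = 0.
  rewrite in_itv/= => /andP[x1 x2].
  have := Rintegral_itvB int1 (x := x); rewrite !bnd_simp => /(_ (ltW x1) (ltW x2)).
  rewrite [\int[mu]_(t in `[-1, 1]) f t]q0 sub0r => e.
  apply/eqP; rewrite eq_le Rintegral_ge0// andbT -oppr_ge0 e.
  by apply: Rintegral_ge0.
have root x : x \in `]-1, 1[ -> root q x.
  move=> xI; have := xI; rewrite in_itv/= => /andP[x1 x2].
  have cx : {for x, continuous f}.
    by apply: cvgM; [exact: continuous_horner|exact: continuous_jweight].
  have [_ d2] := continuous_FTC1_closed x2 int1 x1 cx.
  have : f x = 0.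
    rewrite -d2 derive1E; transitivity ('D_1 (cst (0 : R)) x); last first.
      by rewrite -derive1E derive1_cst.
    apply: near_eq_derive => //; near=> y; rewrite /cst F0//.
    by near: y; exact: near_in_itvoo.
  rewrite /f horner_exp /jweight => /eqP.
  rewrite !mulf_eq0 orbb !powR_eq0 /root.
  have -> : (1 - x == 0) = false by rewrite gt_eqF//; lra.
  have -> : (1 + x == 0) = false by rewrite gt_eqF//; lra.
  by rewrite !andFb !orbF.
apply/eqP; apply: contraT => qn0.
(* 1/2, 1/3, ..., 1/(size q + 1) are more distinct roots than q can have. *)
pose rs : seq R := [seq k.+2%:R^-1 | k <- iota 0 (size q)].
have : (size rs < size q)%N.
  apply: max_poly_roots => //.
    apply/allP => _ /mapP[k _ ->]; apply: root.
    rewrite in_itv/=; apply/andP; split.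
      by apply: (@lt_trans _ _ 0); rewrite ?invr_gt0 ?ltr0n//; lra.
    by rewrite invf_lt1 ?ltr0n// ltr1n.
  rewrite map_inj_uniq ?iota_uniq// => k l /invr_inj/eqP.
  by rewrite eqr_nat => /eqP[].
by rewrite size_map size_iota ltnn.
Unshelve. all: by end_near. Qed.

(** Lagrange's identity: the Wronskian of two eigenfunctions times w_(a + 1, b + 1)
has derivative (la_i - la_j) P_i P_j w_(a, b) and vanishes at both endpoints,
and the eigenvalues la_n = n (n + a + b + 1) are distinct. *)
Lemma jacobi_poly_ortho a b i j : -1 < a -> -1 < b -> i != j ->
  jmoment a b 1 (jacobi_poly a b i * jacobi_poly a b j) = 0.
Proof.
move=> a1 b1 ij.
have a0 : 0 < a + 1 by lra.
have b0 : 0 < b + 1 by lra.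
have I1 : 1 \in `[(-1 : R), 1] by rewrite in_itv/=; apply/andP; split; lra.
pose P := jacobi_poly a b i; pose Q := jacobi_poly a b j.
have := Rintegral_jweight_derivative (P * Q^`() - Q * P^`()) a0 b0 I1.
have w0 : jweight (a + 1) (b + 1) 1 = 0.
  by rewrite /jweight subrr powR0 ?mul0r// gt_eqF.
rewrite w0 mulr0 !addrK.
pose la n : R := n%:R * (n%:R + a + b + 1).
rewrite (_ : _ + _ = (la i - la j) *: (P * Q)); last first.
  have eP := jacobi_poly_ode b i a1; have eQ := jacobi_poly_ode b j a1.
  rewrite -/P in eP; rewrite -/Q in eQ.
  rewrite derivB !derivM.
  set D := (b + 1) *: _ - _ in eP eQ *.
  transitivity (P * ((1 - 'X ^+ 2) * Q^`()^`() + D * Q^`())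
     - Q * ((1 - 'X ^+ 2) * P^`()^`() + D * P^`())); first by ring.
  by rewrite eP eQ -!mul_polyC -/(la i) -/(la j) !(polyCB, polyCN); ring.
rewrite -/(jmoment a b 1 _) jmomentZ// => /eqP; rewrite mulf_eq0 => /orP[|/eqP//].
rewrite (_ : la i - la j = (i%:R - j%:R) * (i%:R + j%:R + a + b + 1)); last first.
  by rewrite /la; ring.
rewrite mulf_eq0 subr_eq0 eqr_nat (negbTE ij)/= gt_eqF//.
have : 1 <= i%:R + j%:R :> R.
  rewrite -natrD ler1n addn_gt0.
  by case: i j ij {P Q la} => [|i] [|j].
lra.
Qed.

(** The polynomials of degree below j are spanned by the members of index below j,
as there is one of each degree. *)
Lemma orthogonal_lower a b (P : nat -> {poly R}) n j q : -1 < a -> -1 < b ->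
  (forall j, size (P j) = j.+1) ->
  (forall i j, i != j -> jmoment a b 1 (P i * P j) = 0) ->
  (size q <= n)%N -> (n <= j)%N -> jmoment a b 1 (q * P j) = 0.
Proof.
move=> a1 b1 sP oP.
have I1 : 1 \in `[(-1 : R), 1] by rewrite in_itv/=; apply/andP; split; lra.
elim: n q => [|n IH] q sq nj.
  move: sq; rewrite leqn0 size_poly_eq0 => /eqP ->.
  by rewrite mul0r -(scale0r 0) jmomentZ// mul0r.
pose c := q`_n / (P n)`_n.
have Pn0 : (P n)`_n != 0.
  by have := lead_coefE (P n); rewrite sP /= => <-; rewrite lead_coef_eq0 -size_poly_eq0 sP.
rewrite -(subrK (c *: P n) q) mulrDl jmomentD// IH//; last 2 first.
- apply/leq_sizeP => k; rewrite leq_eqVlt => /predU1P[<-|nk].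
    by rewrite coefB coefZ /c divfK// subrr.
  rewrite coefB coefZ !nth_default ?mulr0 ?subr0// ?sP//.
  exact: leq_trans nk.
- exact: ltnW.
by rewrite add0r -scalerAl jmomentZ// oP ?mulr0// ltn_eqF.
Qed.

(** Subtracting the multiple of Q j with the same leading coefficient from P j
leaves a polynomial of degree below j that is orthogonal to P j and Q j, hence
to itself. *)
Lemma orthogonal_system_unique a b (P Q : nat -> {poly R}) : -1 < a -> -1 < b ->
  (forall j, size (P j) = j.+1) ->
  (forall i j, i != j -> jmoment a b 1 (P i * P j) = 0) ->
  (forall j, size (Q j) = j.+1) ->
  (forall i j, i != j -> jmoment a b 1 (Q i * Q j) = 0) ->
  forall j, exists c, P j = c *: Q j.
Proof.
move=> a1 b1 sP oP sQ oQ j.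
have I1 : 1 \in `[(-1 : R), 1] by rewrite in_itv/=; apply/andP; split; lra.
exists ((P j)`_j / (Q j)`_j); set c := _ / _.
have Qj0 : (Q j)`_j != 0.
  by have := lead_coefE (Q j); rewrite sQ /= => <-; rewrite lead_coef_eq0 -size_poly_eq0 sQ.
pose d := P j - c *: Q j.
have sd : (size d <= j)%N.
  apply/leq_sizeP => k; rewrite leq_eqVlt => /predU1P[<-|nk].
    by rewrite coefB coefZ /c divfK// subrr.
  by rewrite coefB coefZ !nth_default ?mulr0 ?subr0// ?sP ?sQ.
apply/eqP; rewrite -subr_eq0; apply/eqP; apply: (jmoment_sqr_eq0 a1 b1).
rewrite -/d expr2 {2}/d mulrBr -scalerAr -scaleNr jmomentD// jmomentZ//.
by rewrite !(orthogonal_lower a1 b1 _ _ sd)// mulr0 addr0.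
Qed.

Lemma jacobiE a b n : 0 < a -> 0 < b -> jacobi a b n = jacobi_poly a b n.
Proof.
move=> a0 b0.
have a1 : -1 < a by lra.
have b1 : -1 < b by lra.
have J : jacobi_system a b (jacobi_poly a b).
  split=> [j|i j ij|j].
  - exact: size_jacobi_poly.
  - rewrite -(jacobi_poly_ortho a1 b1 ij).
    by apply: eq_Rintegral => t _; rewrite hornerM.
  - by rewrite jacobi_polyE1 Gamma_ratio// ltW.
have [s o e] : jacobi_system a b (jacobi a b).
  exact: (@xgetPex _ (fun=> 0) [set P | jacobi_system a b P]) (ex_intro _ _ J).
have [sJ _ eJ] := J.
have o' i j : i != j -> jmoment a b 1 (jacobi a b i * jacobi a b j) = 0.
  by move=> ij; rewrite -(o i j ij); apply: eq_Rintegral => t _; rewrite hornerM.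
have [c ec] := orthogonal_system_unique a1 b1 s o' sJ (fun i j => @jacobi_poly_ortho a b i j a1 b1) n.
have := e n; rewrite ec hornerZ -eJ jacobi_polyE1.
have nz : pochhammer (a + 1) n / n`!%:R != 0.
  rewrite mulf_neq0 ?invr_eq0 ?pnatr_eq0 -?lt0n ?fact_gt0//.
  by rewrite gt_eqF// pochhammer_gt0//; lra.
by rewrite -[RHS]mul1r => /(mulIf nz) ->; rewrite scale1r.
Qed.

(** * The decomposition *)

(** Column j + 1 of the decomposition at one node.  All integrals but the boundary
term are moments for the weight w_(a - 1, b - 1), so the claim reduces to an
identity of polynomials: the product rule combined with the three-term
recurrence. *)
Lemma jac_psi_decomposition a b j x : 0 < a -> 0 < b -> x \in `[-1, 1] ->
  jac_psi a b j.+1 x = jac_r a b j.+1 x +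
   (jac_I a b j x * coef_l a b j.+1 + jac_I a b j.+1 x * coef_d a b j.+1
     + jac_I a b j.+2 x * coef_u a b j.+1).
Proof.
move=> a0 b0 xI.
have a1 : -1 < a - 1 by lra.
have b1 : -1 < b - 1 by lra.
have n0 := ler0n R j.
have s0 : j.+1%:R + a + b + 1 != 0 by rewrite -natr1 gt_eqF//; lra.
have IE r : jac_I a b r x = jmoment (a - 1) (b - 1) x (jacobi_poly a b r).
  by rewrite /jac_I jacobiE.
rewrite !IE /jac_r (jacobiE _ a0 b0).
have -> : jac_psi a b j.+1 x =
    jmoment (a - 1) (b - 1) x ((1 - 'X ^+ 2) * jacobi_poly (a + 1) (b + 1) j).
  rewrite /jac_psi jacobiE; [|lra|lra].
  apply: eq_Rintegral => t /set_mem/=; rewrite in_itv/= => /andP[t1 tx].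
  rewrite (jweight_mul_onem2 a0 b0); last first.
    by move: xI; rewrite !in_itv/= t1/= => /andP[_]; exact: le_trans.
  by rewrite hornerM !hornerE /=; ring.
rewrite -mulrA -(Rintegral_jweight_derivative _ a0 b0 xI).
rewrite -/(jmoment (a - 1) (b - 1) x _) jacobi_poly_deriv//.
set s := j.+1%:R + a + b + 1 in s0 *.
pose k : R := 2 / s.
rewrite -/k -(jmomentZ _ _ a1 b1 xI).
rewrite [X in _ + (X + _ + _)]mulrC [X in _ + (_ + X + _)]mulrC [X in _ + (_ + X)]mulrC.
rewrite -!(jmomentZ _ _ a1 b1 xI) -!(jmomentD _ _ a1 b1 xI).
congr jmoment.
have t3 := jacobi_poly_three_term j a0 b0.
have -> : coef_l a b j.+1 = k * ((a + b) * rec_c a b j.+1).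
  by rewrite /coef_l /k -/s; field.
have -> : coef_d a b j.+1 = k * ((a - b) + (a + b) * rec_b a b j.+1).
  by rewrite /coef_d /k -/s; field.
have -> : coef_u a b j.+1 = k * ((a + b) * rec_a a b j.+1).
  by rewrite /coef_u /k -/s; field.
have -> : (1 - 'X ^+ 2) * jacobi_poly (a + 1) (b + 1) j =
    k *: ((1 - 'X ^+ 2) * ((s / 2) *: jacobi_poly (a + 1) (b + 1) j)).
  rewrite -scalerAr scalerA (_ : k * _ = 1) ?scale1r// /k.
  by field.
rewrite -!scalerA -!scalerDr; congr (_ *: _).
have -> : (b *: (1 - 'X) - a *: (1 + 'X)) * jacobi_poly a b j.+1 =
   (b - a) *: jacobi_poly a b j.+1 - (a + b) *: ('X * jacobi_poly a b j.+1).
  by rewrite -!mul_polyC !polyCD !polyCN; ring.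
rewrite t3 -!mul_polyC !(polyCD, polyCN, polyCM); ring.
Qed.

End JacobiMoments.

Lemma sum_ord_eq (V : nmodType) (n m : nat) (F : nat -> V) : (m < n)%N ->
  \sum_(i < n) (if i == m :> nat then F i else 0) = F m.
Proof. by move=> mn; rewrite -big_mkcond big_ord1_eq mn. Qed.

Theorem theorem2p8 (R : realType) (alpha beta : R) (N : nat)
    (x : 'I_N.+1 -> R) (halpha : 0 < alpha) (hbeta : 0 < beta)
    (hN : (1 <= N)%N) (hx0 : x ord0 = -1) (hxN : x ord_max = 1)
    (hx : forall i j : 'I_N.+1, (i < j)%N -> x i < x j) :
  Psi_mx alpha beta x =
    R_mx alpha beta x + Iext_mx alpha beta x *m TJ_mx alpha beta N.
Proof.
apply/matrixP => k j; rewrite !mxE.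
have xk : x k \in `[-1, 1].
  rewrite in_itv/= -hx0 -hxN; apply/andP; split.
    have [->//|k0] := eqVneq k ord0.
    by apply/ltW/hx; rewrite lt0n; apply: contra k0 => /eqP k0; apply/eqP/val_inj.
  have [->//|kN] := eqVneq k ord_max.
  apply/ltW/hx; rewrite ltn_neqAle -ltnS ltn_ord andbT.
  by apply: contra kN => /eqP kN; apply/eqP/val_inj.
rewrite jac_psi_decomposition//; congr (_ + _).
(* A column of the banded matrix is the sum of its three diagonals. *)
pose I r := jac_I alpha beta r (x k).
pose on m c (r : nat) := if r == m then I r * c else 0.
transitivity (\sum_(r < N.+2) (on j (coef_l alpha beta j.+1) r
    + on j.+1 (coef_d alpha beta j.+1) r + on j.+2 (coef_u alpha beta j.+1) r)).
  have sum_on m c : (m < N.+2)%N -> \sum_(r < N.+2) on m c r = I m * c.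
    exact: (sum_ord_eq (fun r => I r * c)).
  have jN := ltn_ord j.
  by rewrite !big_split/= !sum_on ?ltnS ?(leqW jN)// ltnW// leqW.
apply: eq_bigr => r _; rewrite !mxE /on.
have [->|_] := eqVneq (r : nat) j.
  by rewrite !ltn_eqF ?addr0// ltnW.
have [->|_] := eqVneq (r : nat) j.+1.
  by rewrite add0r (ltn_eqF (ltnSn _)) addr0.
rewrite !add0r; case: ifP => // _; exact/esym/mulr0.
Qed.
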